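(* Let $S$ and $T$ be two semigroups with $S$ infinite. (1) Suppose $T$ is infinite. Then the direct product $S\times T$ is weakly right noetherian if and only if both $S$ and $T$ are weakly right noetherian and both have local right identities. (2) Suppose $T$ is finite. Then $S\times T$ is weakly right noetherian if and only if $S$ is weakly right noetherian and $T$ has local right identities.
   Context: A right ideal of a semigroup $S$ is a subset $I\subseteq S$ with $IS\subseteq I$; it is finitely generated if $I=X\cup XS$ for some finite $X\subseteq I$. A semigroup is weakly right noetherian if every right ideal of it is finitely generated. A semigroup $S$ has local right identities if $a\in aS$ for every $a\in S$. *)

(* Defs.v *)
From mathcomp Require Import all_boot.
From mathcomp Require Import boolp classical_sets functions cardinality.

Set Implicit Arguments.
Unset Strict Implicit.
Unset Printing Implicit Defensive.

Local Open Scope group_scope.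
Local Open Scope classical_set_scope.

Definition set_mul (S : semigroupType) (A B : set S) : set S :=
  [set a * b | a in A & b in B].

Definition right_ideal (S : semigroupType) (I : set S) : Prop :=
  set_mul I [set: S] `<=` I.

Definition fg_right_ideal (S : semigroupType) (I : set S) : Prop :=
  exists X : set S,
    [/\ finite_set X, X `<=` I & I = X `|` set_mul X [set: S]].

Definition weakly_right_noetherian (S : semigroupType) : Prop :=
  forall I : set S, right_ideal I -> fg_right_ideal I.

Definition has_local_right_identities (S : semigroupType) : Prop :=
  forall a : S, set_mul [set a] [set: S] a.

(* Main.v *)
Require Import Defs.
From mathcomp Require Import all_boot.
From mathcomp Require Import boolp classical_sets functions cardinality.

Set Implicit Arguments.
Unset Strict Implicit.
Unset Printing Implicit Defensive.

Local Open Scope classical_set_scope.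

(** Write [I_s] for the slice [{t | (s, t) \in I}] of a right ideal [I] of
    [S * T].  If [S] is infinite and [t : T], then a finite generating set of
    the right ideal [S * ({t} U tT)] misses some [(s, t)], which therefore is a
    proper product; this gives [t \in tT].
    Conversely, let [T] have local right identities.  If [T] is finite, the
    finitely many slices of [I] along [T] are right ideals of [S], and their
    generators together generate [I].  If both semigroups have local right
    identities, then noetherian induction on the right ideal [J] of [T] shows
    that [I] is finitely generated over any right ideal [D] of [S] such that
    [J] is contained in [I_s] for all [s \in D]: a maximal right ideal
    [D0] inside [D] over which [I] is finitely generated contains all the
    [s \in D] with [I_s] strictly larger than [J], so that over [D] the
    ideal [I] is the union of its part over [D0] and of [D * J]. *)

Lemma right_idealM (S : semigroupType) (I : set S) (a : S) :
  right_ideal I -> I a -> forall b, I (a * b)%g.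
Proof. by move=> rI Ia b; apply: rI; exists a => //; exists b. Qed.

Lemma right_idealI (S : semigroupType) (I J : set S) :
  right_ideal I -> right_ideal J -> right_ideal (I `&` J).
Proof.
by move=> rI rJ _ [a [Ia Ja] [b _ <-]]; split; apply: right_idealM.
Qed.

Lemma right_idealU (S : semigroupType) (I J : set S) :
  right_ideal I -> right_ideal J -> right_ideal (I `|` J).
Proof.
by move=> rI rJ _ [a [Ia|Ja] [b _ <-]]; [left|right]; apply: right_idealM.
Qed.

Lemma right_idealX (S T : semigroupType) (I : set S) (J : set T) :
  right_ideal I -> right_ideal J -> right_ideal (I `*` J : set (S * T)%type).
Proof.
move=> rI rJ _ [a [Ia Ja] [b _ <-]].
by split; [exact: (right_idealM rI)|exact: (right_idealM rJ)].
Qed.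

Lemma right_ideal_preimage (S T : semigroupType) (f : S -> T) (I : set T) :
  {morph f : x y / (x * y)%g} -> right_ideal I -> right_ideal (f @^-1` I).
Proof.
move=> fM rI _ [a Ia [b _ <-]].
by rewrite /preimage/= fM; exact: (right_idealM rI).
Qed.

Lemma right_ideal_bigcup (S : semigroupType) (F : set (set S)) :
  F `<=` @right_ideal S -> right_ideal (\bigcup_(A in F) A).
Proof.
move=> rF _ [a [A FA Aa] [b _ <-]].
by exists A => //; exact: (right_idealM (rF _ FA)).
Qed.

Lemma right_ideal_gen (S : semigroupType) (X : set S) :
  right_ideal (X `|` set_mul X setT).
Proof.
move=> _ [a + [b _ <-]] => -[Xa|[x Xx [c _ <-]]]; right.
  by exists a => //; exists b.
by exists x => //; exists (c * b)%g => //; rewrite mulgA.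
Qed.

Lemma fg_right_idealP (S : semigroupType) (I X : set S) :
  right_ideal I -> finite_set X -> X `<=` I -> I `<=` X `|` set_mul X setT ->
  fg_right_ideal I.
Proof.
move=> rI finX XI IX; exists X; split => //; apply/seteqP; split => // a.
by case=> [/XI//|[x /XI Ix [b _ <-]]]; apply: right_idealM.
Qed.

Lemma fg_right_idealU (S : semigroupType) (I J : set S) :
  right_ideal I -> right_ideal J ->
  fg_right_ideal I -> fg_right_ideal J -> fg_right_ideal (I `|` J).
Proof.
move=> rI rJ [X [finX XI IX]] [Y [finY YJ JY]].
apply: (@fg_right_idealP _ _ (X `|` Y)).
- exact: right_idealU.
- by rewrite finite_setU.
- exact: setUSS.
- move=> a [|]; rewrite ?IX ?JY.
  + case=> [Xa|[x Xx [b _ <-]]]; first by left; left.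
    by right; exists x; [left|exists b].
  + case=> [Ya|[y Yy [b _ <-]]]; first by left; right.
    by right; exists y; [right|exists b].
Qed.

Lemma local_right_identity_gen (S : semigroupType) (X : set S) :
  has_local_right_identities S -> X `|` set_mul X setT = set_mul X setT.
Proof.
move=> lS; apply/seteqP; split => [a [Xa|//]|a]; last by right.
by have [_ -> [b _ ab]] := lS a; exists a => //; exists b.
Qed.

Lemma fg_right_idealX (S T : semigroupType) (I : set S) (J : set T) :
  has_local_right_identities S -> has_local_right_identities T ->
  right_ideal I -> right_ideal J -> fg_right_ideal I -> fg_right_ideal J ->
  fg_right_ideal (I `*` J : set (S * T)%type).
Proof.
move=> lS lT rI rJ [X [finX XI IX]] [Y [finY YJ JY]].
apply: (@fg_right_idealP _ _ (X `*` Y)).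
- exact: right_idealX.
- exact: finite_setX.
- by move=> a [/XI ? /YJ ?].
(* Local right identities make even a generator a proper multiple of a generator, which removes the
   mixed pairs: [(x, y * c)] is a multiple of [(x, y)] once [x = x' * b] is available in the form
   used here. *)
- move=> [s t] []/=; rewrite IX JY !local_right_identity_gen//.
  move=> [x Xx [b _ <-]] [y Yy [c _ <-]].
  by right; exists (x, y) => //; exists (b, c).
Qed.

(** Images of generators of the preimage of [I] generate [I], since every element of [I] is a value
    of [f]. *)
Lemma wrn_surjective (S T : semigroupType) (f : S -> T) :
  {morph f : x y / (x * y)%g} -> range f = setT ->
  weakly_right_noetherian S -> weakly_right_noetherian T.
Proof.
move=> fM fT wS I rI.
have [X [finX XI IX]] := wS _ (right_ideal_preimage fM rI).
apply: (@fg_right_idealP _ _ (f @` X)) => //.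
- exact: finite_image.
- by move=> _ [x /XI ? <-].
- move=> t It; have [s _ fs] : range f t by rewrite fT.
  have : (f @^-1` I) s by rewrite /preimage/= fs.
  rewrite IX -fs => -[Xs|[x Xx [b _ <-]]]; first by left; exists s.
  by right; exists (f x); [exists x|exists (f b)].
Qed.

Lemma finite_sub_chain (T : choiceType) (F : set (set T)) (X : set T) :
  F !=set0 -> total_on F subset -> finite_set X ->
  X `<=` \bigcup_(A in F) A -> exists2 A, F A & X `<=` A.
Proof.
move=> [A0 FA0] totF /finite_seqP[s ->]; elim: s => [_|x s IHs sF].
  by exists A0.
have [|A FA sA] := IHs; first by move=> y ys; apply: sF; rewrite /= inE ys orbT.
have [|B FB Bx] := sF x; first by rewrite /= mem_head.
have [AB|BA] := totF _ _ FA FB.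
  by exists B => // y; rewrite /= inE => /orP[/eqP->//|/sA/AB].
by exists A => // y; rewrite /= inE => /orP[/eqP->|/sA//]; exact: BA.
Qed.

(** Zorn's lemma applies: the union of a nonempty chain of right ideals is finitely generated, and
    its generators lie in one member, which is then the whole union. The empty chain is covered by
    [P set0]. *)
Lemma wrn_maximal (S : semigroupType) (P : set (set S)) :
  weakly_right_noetherian S -> P set0 ->
  exists A, [/\ right_ideal A, P A &
    forall B, right_ideal B -> A `<` B -> ~ P B].
Proof.
move=> wS P0; have [|A [[rA PA] maxA]] :=
    @Zorn_bigcup S [set A | right_ideal A /\ P A]; last first.
- by exists A; split => // B rB AB PB; exact: maxA AB _.
move=> F FP totF.
have rF : right_ideal (\bigcup_(A in F) A).
  by apply: right_ideal_bigcup => A /FP[].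
split => //; have [F0|/set0P F0] := eqVneq F set0.
  by rewrite F0 bigcup_set0.
have [X [finX XF FX]] := wS _ rF.
have [A FA XA] := finite_sub_chain F0 totF finX XF.
have [rA PA] := FP _ FA.
suff -> : \bigcup_(A in F) A = A by [].
apply/seteqP; split => [a|a Aa]; last by exists A.
by rewrite FX => -[/XA//|[x /XA Ax [b _ <-]]]; apply: right_idealM.
Qed.

Lemma wrn_prod_local_right_identities (S T : semigroupType) :
  infinite_set [set: S] -> weakly_right_noetherian (S * T)%type ->
  has_local_right_identities T.
Proof.
move=> infS wST t; set J := [set t] `|` set_mul [set t] setT.
have [|X [finX XI IX]] := wST (setT `*` J).
  by apply: right_idealX => //; exact: right_ideal_gen.
have [s Xs] : exists s, ~ X (s, t).
  apply: contrapT => /forallNP XT; apply: infS.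
  apply: sub_finite_set (finite_image fst finX) => s _.
  by exists (s, t) => //; apply: contrapT; exact: XT.
have : (setT `*` J) (s, t) by split => //; left.
rewrite IX => -[//|[[x y] /XI[_ /= Jy] [[u v] _ [_ yv]]]].
(* Here [t = y * v] with [y] in [J], so [t = t * v] or [t = t * w * v]. *)
case: Jy yv => [->|[_ -> [w _ <-]]] /= tE; first by exists t => //; exists v.
by exists t => //; exists (w * v)%g => //; rewrite mulgA.
Qed.

Lemma wrn_prod_finite (S T : semigroupType) :
  finite_set [set: T] -> weakly_right_noetherian S ->
  has_local_right_identities T -> weakly_right_noetherian (S * T)%type.
Proof.
move=> finT wS lT I rI.
(* A local right identity [e] of [t] freezes the second coordinate:
   [(s, t) * (u, e) = (s * u, t)]. *)
have rIt t : right_ideal [set s | I (s, t)].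
  move=> _ [s Is [u _ <-]]; have [_ -> [e _ te]] := lT t.
  by rewrite /= -{1}te; exact: (right_idealM rI Is (u, e)).
have [X XP] := choice (fun t => wS _ (rIt t)).
apply: (@fg_right_idealP _ _ (\bigcup_t ((fun s => (s, t)) @` X t))) => //.
- by apply: bigcup_finite => // t _; apply: finite_image; case: (XP t).
- by move=> _ [t _ [s Xs <-]]; have [_ XI _] := XP t; exact: XI.
- move=> [s t] Ist; have [_ _ IX] := XP t.
  have : [set s | I (s, t)] s by [].
  rewrite IX => -[Xs|[x Xx [u _ <-]]]; first by left; exists t => //; exists s.
  have [_ -> [e _ te]] := lT t; right; exists (x, t).
    by exists t => //; exists x.
  by exists (u, e) => //; congr pair.
Qed.

Lemma wrn_prod (S T : semigroupType) :
  weakly_right_noetherian S -> weakly_right_noetherian T ->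
  has_local_right_identities S -> has_local_right_identities T ->
  weakly_right_noetherian (S * T)%type.
Proof.
move=> wS wT lS lT I rI.
have rIs s : right_ideal [set t | I (s, t)].
  move=> _ [t It [u _ <-]]; have [_ -> [e _ se]] := lS s.
  by rewrite /= -{1}se; exact: (right_idealM rI It (e, u)).
(* Slices can only grow under right multiplication in [S]. *)
have Isub s u t : I (s, t) -> I ((s * u)%g, t).
  move=> Ist; have [_ -> [e _ te]] := lT t.
  by rewrite -te; exact: (right_idealM rI Ist (u, e)).
have rID D : right_ideal D -> right_ideal (I `&` D `*` setT).
  by move=> rD; apply: right_idealI => //; exact: right_idealX.
pose good J := forall D, right_ideal D ->
  (forall s, D s -> J `<=` [set t | I (s, t)]) ->
  fg_right_ideal (I `&` D `*` setT).
suff /(_ setT) : good set0.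
  by rewrite setXTT setIT; apply => // s _; exact: sub0set.
apply: contrapT => bad0.
(* The induction runs through a maximal counterexample: every right ideal properly containing [J] is
   [good]. *)
have [J [rJ badJ maxJ]] := @wrn_maximal _ [set J | ~ good J] wT bad0.
apply: badJ => D rD DJ.
have [|D0 [rD0 [D0D fgD0] maxD0]] := @wrn_maximal _
    [set E | E `<=` D /\ fg_right_ideal (I `&` E `*` setT)] wS.
  split => //; exists set0; split => //; apply/seteqP; split => //.
  - by move=> ? [? []].
  - by move=> ? [//|[]].
suff -> : I `&` D `*` setT = (I `&` D0 `*` setT) `|` D `*` J.
  apply: fg_right_idealU => //; [exact: rID|exact: right_idealX|].
  by apply: fg_right_idealX; rewrite //; [exact: wS|exact: wT].
apply/seteqP; split => [[s t] [Ist [Ds _]]|[s t] [[? [/D0D]]|[Ds Jt]]] //;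
  last by split => //; exact: DJ Jt.
have [D0s|D0s] := pselect (D0 s); [by left|right; split => //=].
apply: contrapT => Jt.
(* As [t] lies outside [J], [K] is strictly larger than [J], hence [good], and it is contained in
   the slice at every point of [E]. So [I] is finitely generated over [E], thus over the union of
   [D0] and [E], against the maximality of [D0]. *)
pose K := J `|` ([set t] `|` set_mul [set t] setT).
pose E := [set s] `|` set_mul [set s] setT.
have rE : right_ideal E by exact: right_ideal_gen.
have ED : E `<=` D.
  by move=> _ [->//|[_ -> [u _ <-]]]; exact: right_idealM.
have goodK : good K.
  apply: contrapT; apply: maxJ; first exact/right_idealU/right_ideal_gen.
  split; first exact: subsetUl.
  by move=> /(_ t) KJ; apply/Jt/KJ; right; left.
apply: (maxD0 (D0 `|` E)).
- exact: right_idealU.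
- split; first exact: subsetUl.
  by move=> /(_ s) ED0; apply/D0s/ED0; right; left.
- split; first by rewrite subUset.
  have -> : I `&` (D0 `|` E) `*` setT =
      (I `&` D0 `*` setT) `|` (I `&` E `*` setT).
    apply/seteqP; split=> [[a b] [Iab [[D0a|Ea] _]]|[a b]]; [by left|by right|].
    by case=> -[Iab [Ha _]]; split => //; split => //; [left|right].
  apply: fg_right_idealU => //; [exact: rID|exact: rID|].
  apply: goodK => // a Ea b [Jb|]; first exact: DJ (ED _ Ea) _ Jb.
  have Iat : I (a, t) by case: Ea => [->//|[_ -> [u _ <-]]]; exact: Isub.
  by case=> [->//|[_ -> [u _ <-]]]; exact: (right_idealM (rIs a)).
Qed.

(* A [semigroupType] may be empty, whereas semigroups are nonempty by
   convention; (2) fails for empty T, hence [T_nonempty]. *)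
Theorem theorem6p1 (S T : semigroupType)
    (S_infinite : infinite_set [set: S]) (T_nonempty : [set: T] !=set0) :
  (infinite_set [set: T] ->
    (weakly_right_noetherian (S * T)%type <->
      (weakly_right_noetherian S /\ weakly_right_noetherian T) /\
      (has_local_right_identities S /\ has_local_right_identities T))) /\
  (finite_set [set: T] ->
    (weakly_right_noetherian (S * T)%type <->
      weakly_right_noetherian S /\ has_local_right_identities T)).
Proof.
(* These base points make both projections of [S * T] surjective. *)
have [t0 _] := T_nonempty; have [s0 _] := infinite_setN0 S_infinite.
have wST_S : weakly_right_noetherian (S * T)%type -> weakly_right_noetherian S.
  apply: (@wrn_surjective _ _ fst) => //.
  by apply/seteqP; split => // s _; exists (s, t0).
have lT := @wrn_prod_local_right_identities S T S_infinite.
split=> [T_infinite|T_finite]; split.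
- move=> wST; split; split; [exact: wST_S| |  |exact: lT].
  + apply: (@wrn_surjective _ _ snd) wST => //.
    by apply/seteqP; split => // t _; exists (s0, t).
  (* The infinite factor is now [T], so the two factors are exchanged. *)
  + apply: wrn_prod_local_right_identities T_infinite _.
    apply: (@wrn_surjective _ _ (fun x : S * T => (x.2, x.1))) wST => //.
    by apply/seteqP; split => // -[t s] _; exists (s, t).
- by move=> [[wS wT] [lS lT']]; exact: wrn_prod.
- by move=> wST; split; [exact: wST_S|exact: lT].
- by move=> [wS lT']; exact: wrn_prod_finite.
Qed.
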